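(* Let $p$ be a prime and let $G$ be a nilpotent group of order $p^n r$ with $\gcd(p,r)=1$. Then over any field of characteristic $p$, the slice rank of the multiplication tensor of $G$ is at least $3p^n r/2^{n+2}$.
   Context: For finite sets $X,Y,Z$ and a field $\mathbb{F}$, the slice rank of $F\colon X\times Y\times Z\to\mathbb{F}$ is the smallest $r$ such that, for some $0\le a\le b\le r$ and some functions $f_i,g_i$ with values in $\mathbb{F}$, $F(x,y,z)=\sum_{i=1}^a f_i(x,y)g_i(z)+\sum_{i=a+1}^b f_i(x,z)g_i(y)+\sum_{i=b+1}^r f_i(y,z)g_i(x)$. The multiplication tensor $M_G\colon G\times G\times G\to\mathbb{F}$ of a finite group $G$ is given by $M_G(x,y,z)=1$ if $xy=z$ and $0$ otherwise. *)

(* Defs.v *)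
From HB Require Import structures.
From mathcomp Require Import all_boot all_order all_algebra all_fingroup all_solvable.
From mathcomp Require Import boolp.

Set Implicit Arguments.
Unset Strict Implicit.
Unset Printing Implicit Defensive.

Import GRing.Theory.

Local Open Scope ring_scope.

(* The indices 1, ..., r of the mathematical sum are shifted to 0, ..., r - 1.
   The f_i and g_i have different domains in the three ranges of i, hence the
   three families; their values outside the range of i play no role. *)
Definition slice_decomposable (F : fieldType) (X Y Z : finType)
    (T : X -> Y -> Z -> F) (r : nat) : Prop :=
  exists a b : nat, (a <= b <= r)%N /\
  exists (f1 : nat -> X -> Y -> F) (g1 : nat -> Z -> F)
         (f2 : nat -> X -> Z -> F) (g2 : nat -> Y -> F)
         (f3 : nat -> Y -> Z -> F) (g3 : nat -> X -> F),
  forall (x : X) (y : Y) (z : Z),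
    T x y z = \sum_(0 <= i < a) f1 i x y * g1 i z
            + \sum_(a <= i < b) f2 i x z * g2 i y
            + \sum_(b <= i < r) f3 i y z * g3 i x.

Lemma slice_decomposable_card (F : fieldType) (X Y Z : finType)
  (T : X -> Y -> Z -> F) : slice_decomposable T #|Z|.
Proof.
exists #|Z|, #|Z|; split; first by rewrite leqnn.
exists (fun i x y => if insub i is Some j
                     then T x y (enum_val (j : 'I_#|Z|)) else 0).
exists (fun i z => (i == enum_rank z :> nat)%:R).
exists (fun _ _ _ => 0), (fun _ _ => 0), (fun _ _ _ => 0), (fun _ _ => 0).
move=> x y z; rewrite !(big_geq (leqnn _)) !addr0 big_mkord.
rewrite (bigD1 (enum_rank z)) //= valK enum_rankK eqxx mulr1 big1 ?addr0 //.
by move=> i /negPf ne; rewrite val_eqE ne mulr0.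
Qed.

Lemma slice_decomposable_ex (F : fieldType) (X Y Z : finType)
  (T : X -> Y -> Z -> F) : exists r : nat, `[< slice_decomposable T r >].
Proof. by exists #|Z|; apply/asboolP/slice_decomposable_card. Qed.

Definition slice_rank (F : fieldType) (X Y Z : finType)
    (T : X -> Y -> Z -> F) : nat :=
  ex_minn (slice_decomposable_ex T).

Definition mul_tensor (F : fieldType) (G : finGroupType) (x y z : G) : F :=
  ((x * y)%g == z)%:R.

(* Main.v *)
(** A slice decomposition with [r] terms amounts to subspaces [U], [V], [W] of
    the group algebra with [U V <= W] and [codim U + codim V + dim W <= r], so
    the left side must be bounded below.

    If [z] is central of order [p], then [x = z - 1] is central and nilpotent,
    and every [x^i K[G] / x^(i+1) K[G]] with [i < p] is a copy of [K[G / <z>]].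
    Filtering by powers of [x] turns [U], [V], [W] into pieces with
    [U_i V_i <= W_(2i)], so at least [p / 2] instances of the bound for [G / <z>]
    add up to one for [G].  This reduces to the case where [p] does not divide
    the order of the group.

    In that case, over an infinite splitting field, the algebra embeds in the
    product of the matrix algebras of its irreducible representations, of degrees
    [n_i] with [sum n_i^2 = |G|], and the same filtering reduces to one matrix
    algebra.  There, if [u] in [U] has maximal rank [n - d], then [v] maps
    [ker u] into [im u] for all [v] in [U], so [codim U >= d^2], while
    [dim W >= dim (u V) >= dim V - d n]; finally
    [d^2 + n^2 - d n >= 3 n^2 / 4]. *)

From HB Require Import structures.
Require Import Defs.
From mathcomp Require Import all_boot all_order all_algebra all_fingroup all_solvable.
From mathcomp Require Import all_character boolp zify.

Set Implicit Arguments.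
Unset Strict Implicit.
Unset Printing Implicit Defensive.

Import GRing.Theory Num.Theory.

Local Open Scope ring_scope.

(** * Infinite fields *)

Definition infinite_field (K : fieldType) : Prop :=
  forall m, exists2 s : seq K, uniq s & (m <= size s)%N.

Lemma infinite_field_rmorph (F K : fieldType) (f : {rmorphism F -> K}) :
  infinite_field F -> infinite_field K.
Proof.
move=> infF m; have [s us ms] := infF m.
by exists (map f s); rewrite ?size_map // map_inj_uniq //; apply: fmorph_inj.
Qed.

(** Gives every field an infinite extension: the powers of ['X] already supply enough distinct
    elements. *)
Lemma infinite_fraction_poly (F : fieldType) :
  infinite_field {fraction {poly F}}.
Proof.
move=> m; exists [seq tofrac ('X^i) | i <- iota 0 m]; last first.
  by rewrite size_map size_iota.
rewrite map_inj_uniq ?iota_uniq // => i j /eqP; rewrite tofrac_eq => /eqP eqX.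
by have /eqP := congr1 (fun p : {poly F} => size p) eqX; rewrite !size_polyXn => /eqP [].
Qed.

(** * Products of subspaces of a matrix algebra *)

Section MatrixSubspaces.

Variable K : fieldType.
Hypothesis infK : infinite_field K.

Lemma exists_not_root (p : {poly K}) : p != 0 -> exists2 t, t != 0 & p.[t] != 0.
Proof.
(* The factor ['X] excludes [t = 0]. *)
move=> p0; pose q := p * 'X; have q0 : q != 0 by rewrite mulf_neq0 ?polyX_eq0.
have [s us ms] := infK (size q).
have /allPn[t _ qt] : ~~ all (root q) s.
  by apply/negP => rs; have := max_poly_roots q0 rs us; rewrite ltnNge ms.
by exists t; move: qt; rewrite rootM rootX negb_or => /andP[].
Qed.

(** The determinant of [A + t *: B] is a polynomial in [t] that does not vanish at [0]. *)
Lemma exists_perturbation_unit n (A B : 'M[K]_n) :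
  A \in unitmx -> exists2 t, t != 0 & A + t *: B \in unitmx.
Proof.
move=> uA; pose p := \det (map_mx polyC A + 'X *: map_mx polyC B).
have pE t : p.[t] = \det (A + t *: B).
  rewrite -[LHS]/(horner_eval t p) -det_map_mx; congr (\det _).
  by apply/matrixP=> i j; rewrite !mxE /= /horner_eval !hornerE.
have p0 : p != 0.
  apply: contraTneq uA => p0; rewrite unitmxE unitfE.
  by have := pE 0; rewrite p0 horner0 scale0r addr0 => <-; rewrite eqxx.
have [t t0 pt] := exists_not_root p0; exists t => //.
by rewrite unitmxE unitfE -pE.
Qed.

(* First-order part of Flanders' theorem: if [x v y] were nonzero, bordering a
   nonsingular minor of [u] by [x] and [y] would give a nonsingular minor of
   [u + t v] for a suitable [t]. *)
Lemma max_rank_ker m n (u v : 'M[K]_(m, n)) (x : 'rV_m) (y : 'cV_n) :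
  (forall t, \rank (u + t *: v)%R <= \rank u)%N ->
  x *m u = 0 -> u *m y = 0 -> x *m v *m y = 0.
Proof.
move=> maxu xu uy; apply/eqP; apply: contraT => d0.
(* Instead of selecting a minor, [R] and [C] compress [u] to the identity of size [\rank u]. *)
pose R := pinvmx (col_base u); pose C := pinvmx (row_base u).
have RuC : R *m u *m C = 1%:M.
  have : R *m (col_base u *m row_base u) *m C = 1%:M.
    rewrite mulmxA mulVpmx ?col_base_full // mul1mx.
    by rewrite mulmxVp ?row_base_free.
  by rewrite mulmx_base.
clearbody R C; pose d := x *m v *m y; pose A := R *m v *m C.
pose b := R *m v *m y; pose c := x *m v *m C.
have uN : block_mx 1%:M 0 c d \in unitmx.
  rewrite unitmxE det_lblock det1 mul1r unitfE det_mx11.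
  by apply: contra d0 => /eqP d0; apply/eqP/rowP=> i; rewrite ord1 d0 mxE.
have [t t0 uNt] := exists_perturbation_unit (block_mx A b 0 0) uN.
pose M := col_mx R x *m (u + t *: v) *m row_mx C y.
(* As [x *m u = 0] and [u *m y = 0], the last row of [M] is a multiple of [t]; with that factor
   removed, [M] is a perturbation of a unit. *)
have ME : M = block_mx 1%:M 0 0 t%:M *m (block_mx 1%:M 0 c d + t *: block_mx A b 0 0).
  rewrite /M scale_block_mx add_block_mx mulmx_block !scaler0 !addr0.
  rewrite !mul1mx !mul0mx !addr0 !add0r !mul_scalar_mx.
  rewrite mul_col_mx mul_col_row !mulmxDr !mulmxDl RuC.
  rewrite -!scalemxAr -!scalemxAl xu -!mulmxA uy !mul0mx !mulmx0 !add0r.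
  by rewrite !mulmxA.
have uM : M \in unitmx.
  by rewrite ME unitmx_mul uNt andbT unitmxE det_lblock det1 mul1r det_scalar1 unitfE.
have rM : \rank M = (\rank u + 1)%N by apply/eqP; rewrite -row_free_unit in uM.
have : (\rank M <= \rank u)%N.
  apply: leq_trans (maxu t); rewrite /M.
  by apply: leq_trans (mxrankM_maxl _ _) _; apply: mxrankM_maxr.
by rewrite rM addn1 ltnn.
Qed.

Lemma exists_max_rank n (U : {vspace 'M[K]_n}) :
  exists2 u, u \in U & forall v, v \in U -> (\rank v <= \rank u)%N.
Proof.
pose P k := `[< exists2 v, v \in U & \rank v = k >].
have exP : exists k, P k by exists 0%N; apply/asboolP; exists 0; rewrite ?mem0v ?mxrank0.
have leP k : P k -> (k <= n)%N by move=> /asboolP[v _ <-]; exact: rank_leq_row.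
case: (ex_maxnP exP leP) => k /asboolP[u Uu <-] maxk; exists u => // v Uv.
by apply: maxk; apply/asboolP; exists v.
Qed.

Let arith n d a b c e u v w :
  (a + d * d = n * n -> b <= d * n -> c + e = v -> e <= w -> u <= a -> c <= b ->
  4 * (u + v) <= 5 * n ^ 2 + 4 * w)%N.
Proof.
move=> ha hb hv hw hu hc.
(* This is [(n - 2 d)^2 >= 0], the source of the constant [3 / 4]. *)
have sq : (4 * (d * n) <= n * n + 4 * (d * d))%N.
  by have [le _] := nat_Cauchy n (2 * d); move: le; rewrite -!mulnn; nia.
by rewrite -mulnn; lia.
Qed.

(** The [5] is [8 - 3]: in terms of codimensions the bound reads
    [codim U + codim V + dim W >= 3 n^2 / 4]. *)
Lemma matrix_subspace_mul_bound n (U V W : {vspace 'M[K]_n}) :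
  (forall u v, u \in U -> v \in V -> u *m v \in W) ->
  (4 * (\dim U + \dim V) <= 5 * n ^ 2 + 4 * \dim W)%N.
Proof.
move=> UVW; have [u Uu maxu] := exists_max_rank U.
(* The rows of [P] span the left kernel of [u] and the columns of [Q] its right kernel. Thus
   [P *m v *m Q = 0] says that [v], acting on row vectors, maps the kernel of [u] into its image. *)
pose P := row_base (kermx u); pose Q := (row_base (kermx u^T))^T.
have Pu : P *m u = 0 by apply/sub_kermxP; rewrite eq_row_base.
have uQ : u *m Q = 0.
  by apply: trmx_inj; rewrite trmx_mul trmxK trmx0; apply/sub_kermxP; rewrite eq_row_base.
have rP : \rank (kermx u) = (n - \rank u)%N by rewrite mxrank_ker.
have rQ : \rank (kermx u^T) = (n - \rank u)%N by rewrite mxrank_ker mxrank_tr.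
pose psi := linfun (mulmxr Q \o mulmx P) : 'Hom('M[K]_n, 'M_(_, _)).
have psiE v : psi v = P *m v *m Q by rewrite lfunE.
have psi_full : limg psi = fullv.
  apply/vspaceP => w; rewrite memvf.
  have [P' PP'] : exists P', P *m P' = 1%:M by exists (pinvmx P); rewrite mulmxVp ?row_base_free.
  have [Q' QQ'] : exists Q', Q' *m Q = 1%:M.
    exists (pinvmx Q^T)^T; apply: trmx_inj.
    by rewrite trmx_mul [X in _ *m X]trmxK mulmxVp ?trmx1 // trmxK row_base_free.
  have -> : w = psi (P' *m w *m Q').
    by rewrite psiE !mulmxA PP' mul1mx -mulmxA QQ' mulmx1.
  by rewrite memv_img ?memvf.
have Uker : (U <= lker psi)%VS.
  apply/subvP=> v Uv; rewrite memv_ker psiE; apply/eqP/matrixP=> i j.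
  have maxuv t : (\rank (u + t *: v)%R <= \rank u)%N by apply: maxu; rewrite memvD ?memvZ.
  have xu : row i P *m u = 0 by rewrite -row_mul Pu row0.
  have uy : u *m col j Q = 0 by rewrite colE mulmxA uQ mul0mx.
  have /matrixP/(_ 0 0) := max_rank_ker maxuv xu uy.
  by rewrite colE mulmxA -!row_mul -colE !mxE => ->.
pose L := linfun (mulmx u) : 'End('M[K]_n).
have LE v : L v = u *m v by rewrite lfunE.
have LV : (L @: V <= W)%VS.
  by apply/subvP=> _ /memv_imgP[v Vv ->]; rewrite LE UVW.
(* If [u *m v = 0], the columns of [v] are combinations of those of [Q]. *)
have kerL : (lker L <= limg (linfun (mulmx Q : 'M_(_, n) -> 'M_n)))%VS.
  apply/subvP=> v; rewrite memv_ker LE => /eqP uv.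
  have : (v^T <= row_base (kermx u^T))%MS.
    by rewrite eq_row_base; apply/sub_kermxP; rewrite -trmx_mul uv trmx0.
  case/submxP=> D vD; rewrite -[v]trmxK vD trmx_mul.
  by rewrite -[_ *m _]/(mulmx _ _) -lfunE memv_img ?memvf.
have dim_psi : (\dim (lker psi) + (n - \rank u) * (n - \rank u) = n * n)%N.
  rewrite -{1}rP -rQ.
  by have := limg_ker_dim psi fullv; rewrite psi_full !dimvf !dim_matrix capfv.
have dim_L : (\dim (lker L) <= (n - \rank u) * n)%N.
  rewrite -rQ; apply: leq_trans (dimvS kerL) _; rewrite -[leqRHS](dim_matrix K) -dimvf.
  by rewrite -(limg_ker_dim (linfun (mulmx Q : 'M_(_, n) -> 'M_n)) fullv) leq_addl.
exact: arith dim_psi dim_L (limg_ker_dim L V) (dimvS LV) (dimvS Uker)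
             (dimvS (capvSr V (lker L))).
Qed.

End MatrixSubspaces.

(** * Filtration by the powers of a nilpotent endomorphism *)

Section NilpotentFiltration.

Variables (K : fieldType) (A B : vectType K).
Variables (X : 'End(A)) (pi : 'Hom(A, B)) (p : nat).
Hypothesis X_nilp : forall a, iter p X a = 0.
Hypothesis pi_full : limg pi = fullv.
Hypothesis ker_pi : lker pi = limg X.

(** The colon space [U : X^i]. Pulling [U] back along [X^i], rather than intersecting it with the
    image of [X^i], puts all graded pieces into the one space [B]. *)
Definition colon (U : {vspace A}) i : {vspace A} := iter i (lfun_preim X) U.

Definition graded_piece U i : {vspace B} := (pi @: colon U i)%VS.

Lemma mem_colon U i a : (a \in colon U i) = (iter i X a \in U).
Proof. by elim: i a => //= i IH a; rewrite -memv_preim IH -iterSr. Qed.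

(** [X] maps [colon U i.+1] onto the part of [colon U i] inside [limg X = lker pi]; the kernel of
    this map is all of [lker X], of dimension [dim B]. *)
Lemma dim_graded_piece U i :
  (\dim (graded_piece U i) + \dim (colon U i.+1) = \dim (colon U i) + dim B)%N.
Proof.
have X0 j : iter j X 0 = 0 by elim: j => //= j ->; rewrite linear0.
have kerX : (lker X <= colon U i.+1)%VS.
  apply/subvP=> a; rewrite memv_ker mem_colon iterSr => /eqP ->.
  by rewrite X0 mem0v.
have imX : (X @: colon U i.+1 = colon U i :&: lker pi)%VS.
  by rewrite ker_pi /= -lpreim_cap_limg lpreimK ?capvSr.
have := limg_ker_dim X (colon U i.+1); rewrite imX (capv_idPr kerX).
have := limg_ker_dim pi (colon U i); rewrite -/(graded_piece U i).
have := limg_ker_dim X fullv; have := limg_ker_dim pi fullv.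
rewrite !capfv pi_full -ker_pi !dimvf.
by move=> e1 e2 e3 e4; apply/eqP; rewrite -(eqn_add2l (\dim (lker pi) + \dim (lker X))); lia.
Qed.

(** The dimensions telescope from [colon U 0 = U] to [colon U p], which is everything by
    nilpotency. *)
Lemma sum_dim_graded_piece U :
  (\sum_(0 <= i < p) \dim (graded_piece U i) + dim A = \dim U + p * dim B)%N.
Proof.
have -> : dim A = \dim (colon U p).
  rewrite -dimvf; congr (\dim _); apply/vspaceP=> a.
  by rewrite memvf mem_colon X_nilp mem0v.
elim: (p) => [|i IH]; first by rewrite big_geq // mul0n addn0.
rewrite big_nat_recr //= -addnA -/(colon U i.+1) dim_graded_piece addnA IH.
by rewrite mulSn; lia.
Qed.

Variables (mulA : A -> A -> A) (mulB : B -> B -> B).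
Hypothesis piM : forall a b, pi (mulA a b) = mulB (pi a) (pi b).
Hypothesis XMl : forall a b, X (mulA a b) = mulA (X a) b.
Hypothesis XMr : forall a b, X (mulA a b) = mulA a (X b).

Lemma graded_piece_mul (U V W : {vspace A}) i j :
  (forall u v, u \in U -> v \in V -> mulA u v \in W) ->
  forall u v, u \in graded_piece U i -> v \in graded_piece V j ->
  mulB u v \in graded_piece W (i + j).
Proof.
move=> UVW _ _ /memv_imgP[a Ua ->] /memv_imgP[b Vb ->].
rewrite -piM memv_img // mem_colon.
have -> : iter (i + j) X (mulA a b) = mulA (iter i X a) (iter j X b).
  rewrite iterD; have -> : iter j X (mulA a b) = mulA a (iter j X b).
    by elim: (j) => //= l ->.
  by elim: (i) => //= l ->.
by rewrite UVW // -mem_colon.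
Qed.

(* [U_i V_i] lies in [W_{2i}], and [2i < p] for the first [ceil(p / 2)] indices:
   only these contribute the constant [c]. *)
Lemma graded_mul_bound c k :
  (forall U V W : {vspace B}, (forall u v, u \in U -> v \in V -> mulB u v \in W) ->
   c + k * (\dim U + \dim V) <= k * (2 * dim B + \dim W))%N ->
  dim A = (p * dim B)%N ->
  (forall U V W : {vspace A}, (forall u v, u \in U -> v \in V -> mulA u v \in W) ->
   uphalf p * c + k * (\dim U + \dim V) <= k * (2 * dim A + \dim W))%N.
Proof.
move=> boundB dimA U V W UVW; set h := uphalf p.
pose f := fun Y i => \dim (graded_piece Y i).
have sumf Y : (\sum_(0 <= i < p) f Y i = \dim Y)%N.
  by apply/eqP; have := sum_dim_graded_piece Y; rewrite -dimA => /eqP; rewrite eqn_add2r.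
have lef Y i : (f Y i <= dim B)%N by rewrite -dimvf dimvS ?subvf.
have hp : (h <= p)%N by rewrite /h uphalf_half; have := odd_double_half p; lia.
have low : (h * c + \sum_(0 <= i < h) k * (f U i + f V i) <=
            \sum_(0 <= i < h) k * (2 * dim B + f W (i + i)))%N.
  have -> : (h * c = \sum_(0 <= i < h) c)%N by rewrite sum_nat_const_nat subn0.
  rewrite -big_split /=; apply: leq_sum => i _.
  by apply: boundB; apply: graded_piece_mul.
(* From [h] on, only the trivial bound [dim B] on each piece is used. *)
have high : (\sum_(h <= i < p) k * (f U i + f V i) <= \sum_(h <= i < p) k * (2 * dim B))%N.
  by apply: leq_sum => i _; rewrite leq_mul2l mul2n -addnn leq_add ?orbT.
have even : (\sum_(0 <= i < h) f W (i + i) <= \dim W)%N.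
  (* The even indices [0, 2, ..., 2h - 2] are distinct and lie below [(h + h).-1], which is at most
     [p] for odd [p] too. *)
  rewrite -(sumf W); apply: (@leq_trans (\sum_(0 <= j < (h + h).-1) f W j)).
    elim: h {low high hp} => [|[|l] IH]; first by rewrite !big_geq.
      by rewrite !big_nat1.
    have -> : ((l.+2 + l.+2).-1 = (l.+1 + l.+1).-1.+2)%N by lia.
    rewrite big_nat_recr // [leqRHS]big_nat_recr // [X in (_ <= X + _)%N]big_nat_recr //=.
    have -> : ((l.+1 + l.+1).-1.+1 = l.+1 + l.+1)%N by lia.
    by rewrite leq_add2r (leq_trans IH) ?leq_addr.
  have le : ((h + h).-1 <= p)%N by rewrite /h uphalf_half; have := odd_double_half p; lia.
  by rewrite (big_cat_nat _ le) //= leq_addr.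
have sumUV : (\sum_(0 <= i < p) k * (f U i + f V i) = k * (\dim U + \dim V))%N.
  by rewrite -big_distrr /= big_split /= !sumf.
move: sumUV low high; rewrite (big_cat_nat _ hp) //= => <- low high.
rewrite addnA; apply: leq_trans (leq_add low high) _.
rewrite -!big_distrr -mulnDr leq_mul2l big_split /= !sum_nat_const_nat subn0.
apply/orP; right; rewrite dimA.
have -> : (2 * (p * dim B) = h * (2 * dim B) + (p - h) * (2 * dim B))%N.
  by rewrite -mulnDl subnKC //; lia.
by lia.
Qed.

End NilpotentFiltration.

(** * The group algebra and its convolution product *)

Definition group_algebra (K : fieldType) (gT : finGroupType) : vectType K :=
  {ffun gT -> K^o}.

Section GroupAlgebra.

Variable K : fieldType.

Implicit Types gT hT : finGroupType.

Lemma dim_group_algebra gT : dim (group_algebra K gT) = #|gT|.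
Proof. by rewrite [dim _]muln1. Qed.

Definition coeff gT (a : group_algebra K gT) (x : gT) : K := (a : {ffun gT -> K^o}) x.

Lemma coeff_is_linear gT x : linear ((@coeff gT)^~ x : group_algebra K gT -> K^o).
Proof. by move=> k a b; rewrite /coeff !ffunE. Qed.

Definition gdelta gT (x : gT) : group_algebra K gT :=
  [ffun y => (y == x)%:R] : {ffun gT -> K^o}.

(** Linear extension from the basis of group elements. [gmap], [gconv] and the representations used
    later are built from it, so identities between them reduce to group elements by [eq_glift]. *)
Definition glift gT (V : lmodType K) (h : gT -> V) (a : group_algebra K gT) : V :=
  \sum_x coeff a x *: h x.

Lemma glift_is_linear gT (V : lmodType K) (h : gT -> V) : linear (glift h).
Proof.
move=> k a b; rewrite /glift scaler_sumr -big_split /=; apply: eq_bigr => x _.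
by rewrite [coeff _ x](coeff_is_linear x) scalerDl scalerA.
Qed.

HB.instance Definition _ gT (V : lmodType K) (h : gT -> V) :=
  GRing.isLinear.Build K (group_algebra K gT) V _ (glift h) (glift_is_linear h).

Lemma coeff_gdelta gT (x y : gT) : coeff (gdelta x) y = (y == x)%:R.
Proof. by rewrite /coeff ffunE. Qed.

Lemma glift_gdelta gT (V : lmodType K) (h : gT -> V) x : glift h (gdelta x) = h x.
Proof.
rewrite /glift (bigD1 x) //= coeff_gdelta eqxx scale1r big1 ?addr0 // => y /negPf ne.
by rewrite coeff_gdelta ne scale0r.
Qed.

Lemma glift_id gT (a : group_algebra K gT) : glift (@gdelta gT) a = a.
Proof.
apply/ffunP=> y; rewrite /glift sum_ffunE (bigD1 y) //= !ffunE eqxx.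
rewrite big1 => [|x /negPf ne]; first by rewrite addr0 [_ *: _]mulr1.
by rewrite !ffunE eq_sym ne [_ *: _]mulr0.
Qed.

Lemma glift_comp gT (V W : lmodType K) (f : {linear V -> W}) (h : gT -> V) a :
  f (glift h a) = glift (f \o h) a.
Proof. by rewrite linear_sum; apply: eq_bigr => x _; rewrite linearZ_LR. Qed.

Lemma eq_glift gT (V : lmodType K) (h h' : gT -> V) : h =1 h' -> glift h =1 glift h'.
Proof. by move=> eqh a; apply: eq_bigr => x _; rewrite eqh. Qed.

Definition gmap gT hT (phi : gT -> hT) : group_algebra K gT -> group_algebra K hT :=
  glift (fun x => gdelta (phi x)).

HB.instance Definition _ gT hT (phi : gT -> hT) := GRing.Linear.on (gmap phi).

Lemma glift_gmap gT hT (V : lmodType K) (h : hT -> V) (phi : gT -> hT) a :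
  glift h (gmap phi a) = glift (h \o phi) a.
Proof. by rewrite /gmap glift_comp; apply: eq_glift => x /=; rewrite glift_gdelta. Qed.

Definition gconv gT (a b : group_algebra K gT) : group_algebra K gT :=
  glift (fun x => glift (fun y => gdelta (x * y)) b) a.

Lemma glift_gconv gT (V : lmodType K) (h : gT -> V) a b :
  glift h (gconv a b) = glift (fun x => glift (fun y => h (x * y)%g) b) a.
Proof.
rewrite /gconv glift_comp; apply: eq_glift => x /=; rewrite glift_comp.
by apply: eq_glift => y /=; rewrite glift_gdelta.
Qed.

(** Three maps instead of one morphism cover both the quotient map and translation by a central
    element on either factor. *)
Lemma gmap_gconv gT hT (phi phi' psi : gT -> hT) a b :
  (forall x y, psi (x * y)%g = (phi x * phi' y)%g) ->
  gmap psi (gconv a b) = gconv (gmap phi a) (gmap phi' b).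
Proof.
move=> psiM; rewrite /gmap glift_gconv /gconv glift_gmap; apply: eq_glift => x /=.
by rewrite glift_gmap; apply: eq_glift => y /=; rewrite psiM.
Qed.

Lemma gmap_id gT (a : group_algebra K gT) : gmap id a = a.
Proof. exact: glift_id. Qed.

Lemma gmap_comp gT hT (kT : finGroupType) (phi : gT -> hT) (psi : hT -> kT) a :
  gmap psi (gmap phi a) = gmap (psi \o phi) a.
Proof. exact: glift_gmap. Qed.

Lemma coeff_glift gT hT (h : gT -> group_algebra K hT) a y :
  coeff (glift h a) y = \sum_x coeff a x * coeff (h x) y.
Proof. by rewrite /coeff /glift sum_ffunE; apply: eq_bigr => x _; rewrite !ffunE. Qed.

Lemma gconvBl gT (a a' b : group_algebra K gT) :
  gconv (a - a') b = gconv a b - gconv a' b.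
Proof. by rewrite /gconv linearB. Qed.

Lemma gconvBr gT (a b b' : group_algebra K gT) :
  gconv a (b - b') = gconv a b - gconv a b'.
Proof.
rewrite /gconv /glift -sumrB; apply: eq_bigr => x _; rewrite -scalerBr.
by rewrite -[X in _ *: X = _]/(glift _ (b - b')) linearB.
Qed.

(* [codim U + codim V + dim W >= c / k] whenever [U V <= W], written without
   subtraction or division. *)
Definition mul_bound gT c k := forall U V W : {vspace group_algebra K gT},
  (forall u v, u \in U -> v \in V -> gconv u v \in W) ->
  (c + k * (\dim U + \dim V) <= k * (2 * #|gT| + \dim W))%N.

End GroupAlgebra.

(** Frobenius in the endomorphism ring gives [(T - 1)^p = T^p - 1 = 0]; [0 < dim A] makes that ring
    nontrivial. *)
Lemma iter_sub_id_nilp (K : fieldType) (A : vectType K) (T : 'End(A)) p :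
  (0 < dim A)%N -> p \in [pchar K] -> (forall a, iter p T a = a) ->
  forall a, iter p (T - \1)%VF a = 0.
Proof.
move=> dimA pK Tp; pose R := lfun_comp_nzRingType dimA.
have iterE n (f : R) a : iter n (f : 'End(A)) a = (f ^+ n : 'End(A)) a.
  by elim: n => [|n IH]; rewrite ?id_lfunE // exprS comp_lfunE -IH.
have pR : p \in [pchar R].
  rewrite inE (pcharf_prime pK); apply/eqP/lfunP=> a.
  have natE n : ((n%:R : R) : 'End(A)) a = n%:R *: a.
    elim: n => [|n IH]; first by rewrite scale0r lfunE.
    by rewrite !mulrS scalerDl scale1r add_lfunE IH id_lfunE.
  by rewrite natE (pcharf0 pK) scale0r lfunE.
move=> a; rewrite (iterE p ((T : R) - 1)) -(pFrobenius_autE pR).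
rewrite (pFrobenius_autB_comm pR (commr1 (T : R))) pFrobenius_aut1 pFrobenius_autE.
by rewrite add_lfunE opp_lfunE -iterE Tp id_lfunE subrr.
Qed.

(** * Passing to the quotient by a central subgroup of order [p] *)

Section CentralQuotient.

Variables (gT : finGroupType) (p : nat) (z : gT).
Hypothesis cz : forall x : gT, (x * z = z * x)%g.
Hypothesis oz : #[z]%g = p.

Let Z := <[z]>%G.
Let hT : finGroupType := coset_of Z.

Let memNZ x : x \in 'N(Z)%g.
Proof.
apply: (subsetP (cent_sub _)); rewrite cent_cycle; apply/cent1P; exact: cz.
Qed.

Let cosetM x y : coset Z (x * y)%g = (coset Z x * coset Z y)%g.
Proof. by rewrite morphM ?memNZ. Qed.

Let rep (c : hT) : gT := repr c.

Let coset_surj (c : hT) : coset Z (rep c) = c.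
Proof. exact: coset_reprK. Qed.

Let NZ : 'N(Z)%g = [set: gT].
Proof. by apply/setP=> x; rewrite memNZ inE. Qed.

Let quotientT : [set: hT] = ([set: gT] / Z)%g.
Proof.
apply/setP=> c; rewrite !inE; apply/esym.
by rewrite -(coset_surj c) mem_quotient ?inE.
Qed.

Lemma nilpotent_central_quotient :
  nilpotent [set: gT] -> nilpotent [set: coset_of <[z]>%G].
Proof. by move=> nilG; rewrite -/hT quotientT; apply: quotient_nil. Qed.

Lemma card_central_quotient : #|gT| = (p * #|{: coset_of <[z]>%G}|)%N.
Proof.
rewrite -/hT -(cardsT hT) quotientT mulnC.
by rewrite card_quotient ?NZ // -cardsT -(Lagrange (subsetT Z)) -oz mulnC.
Qed.

Variable K : fieldType.
Hypothesis pK : p \in [pchar K].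

Let A := group_algebra K gT.
Let B := group_algebra K hT.
Let T : 'End(A) := linfun (gmap (mulg z)).
(** Multiplication by [z - 1], which is nilpotent because [z ^ p = 1] in characteristic [p]. *)
Let X : 'End(A) := (T - \1)%VF.
Let pi : 'Hom(A, B) := linfun (gmap (coset Z)).

Let TE a : T a = gmap (mulg z) a. Proof. by rewrite lfunE. Qed.
Let piE a : pi a = gmap (coset Z) a. Proof. by rewrite lfunE. Qed.
Let XE a : X a = gmap (mulg z) a - a. Proof. by rewrite add_lfunE opp_lfunE TE id_lfunE. Qed.

Let X_nilp a : iter p X a = 0.
Proof.
apply: iter_sub_id_nilp => // [|b].
  by rewrite dim_group_algebra; apply/card_gt0P; exists 1%g.
have iterT n : iter n T b = gmap (mulg (z ^+ n)) b.
  elim: n => [|n IH] /=.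
    by rewrite -[LHS]gmap_id; apply: eq_glift => x; rewrite mul1g.
  by rewrite IH TE gmap_comp; apply: eq_glift => x /=; rewrite mulgA -expgS.
rewrite iterT -[RHS]gmap_id; apply: eq_glift => x.
by rewrite -oz expg_order mul1g.
Qed.

Let pi_full : limg pi = fullv.
Proof.
apply/vspaceP=> b; rewrite memvf.
have -> : b = pi (gmap rep b).
  by rewrite piE gmap_comp -[LHS]gmap_id; apply: eq_glift => c /=; rewrite coset_surj.
by rewrite memv_img ?memvf.
Qed.

Let im_sub_ker : (limg X <= lker pi)%VS.
Proof.
apply/subvP=> _ /memv_imgP[a _ ->]; rewrite memv_ker XE piE linearB /= gmap_comp.
rewrite subr_eq0; apply/eqP; apply: eq_glift => x /=.
by rewrite cosetM coset_id ?cycle_id // mul1g.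
Qed.

Let coeff_translate (a : A) x : coeff (gmap (mulg z) a) (z * x)%g = coeff a x.
Proof.
rewrite coeff_glift (bigD1 x) //= coeff_gdelta eqxx mulr1 big1 ?addr0 // => y /negPf ne.
by rewrite coeff_gdelta (inj_eq (mulgI z)) eq_sym ne mulr0.
Qed.

(* Elements fixed by [z] are constant on cosets, hence pulled back from the
   quotient; this bounds the kernel of [X] and makes [lker pi = limg X] a
   dimension count. *)
Let dim_ker_X : (\dim (lker X) <= #|hT|)%N.
Proof.
pose pull_fun (b : B) : A := [ffun x => coeff b (coset Z x)] : {ffun gT -> K^o}.
have pull_lin : linear pull_fun.
  by move=> k b b'; apply/ffunP=> x; rewrite !ffunE /coeff !ffunE.
pose pull : 'Hom(B, A) := linfun (HB.pack_for {linear B -> A} pull_fun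
  (GRing.isLinear.Build K B A _ pull_fun pull_lin)).
rewrite -(dim_group_algebra K hT) -dimvf -(limg_ker_dim pull fullv).
apply: leq_trans (dimvS _) (leq_addl _ _); apply/subvP=> a.
rewrite memv_ker XE subr_eq0 => /eqP za.
have inv n x : coeff a (z ^+ n * x)%g = coeff a x.
  elim: n => [|n IH]; first by rewrite mul1g.
  by rewrite expgS -mulgA -{1}za coeff_translate.
suff -> : a = pull ([ffun c : hT => coeff a (rep c)] : {ffun hT -> K^o}).
  by rewrite memv_img ?memvf.
rewrite lfunE /=; apply/ffunP=> x; rewrite !ffunE /coeff ffunE -!/(coeff a _).
have : rep (coset Z x) \in (Z :* x)%g.
  by rewrite -val_coset ?memNZ // mem_repr_coset.
by case/rcosetP=> _ /cycleP[n ->] ->; rewrite inv.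
Qed.

Let ker_pi : lker pi = limg X.
Proof.
apply/esym/eqP; rewrite eqEdim im_sub_ker /=.
have := limg_ker_dim X fullv; have := limg_ker_dim pi fullv.
rewrite !capfv pi_full !dimvf !dim_group_algebra; have := dim_ker_X.
by lia.
Qed.

Lemma mul_bound_quotient c k :
  mul_bound K hT c k -> mul_bound K gT (uphalf p * c) k.
Proof.
move=> boundB U V W UVW.
have := graded_mul_bound (mulA := @gconv K gT) (mulB := @gconv K hT)
  X_nilp pi_full ker_pi.
rewrite !dim_group_algebra; apply=> //; last exact: card_central_quotient.
- by move=> a b; rewrite !piE; apply: gmap_gconv.
- move=> a b; rewrite !XE gconvBl; congr (_ - _).
  by rewrite -[in RHS](gmap_id b); apply: gmap_gconv => x y; rewrite mulgA.
- move=> a b; rewrite !XE gconvBr; congr (_ - _).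
  rewrite -[in RHS](gmap_id a); apply: gmap_gconv => x y.
  by rewrite !mulgA cz.
Qed.

End CentralQuotient.

(** * Groups of order prime to the characteristic *)

Section Semisimple.

Variables (K : fieldType) (gT : finGroupType).
Hypothesis infK : infinite_field K.
Let G := [set: gT]%G.
Variable sG : irrType K G.
Hypothesis K'G : ([pchar K]^').-group%g G.
Hypothesis splitG : group_splitting_field K G.

Let A := group_algebra K gT.

Let chi (i : sG) : 'Hom(A, 'M[K]_(irr_degree i)) := linfun (glift (irr_repr i)).

Let chiE i a : chi i a = glift (irr_repr i) a.
Proof. by rewrite lfunE. Qed.

Let chiM i a b : chi i (gconv a b) = chi i a *m chi i b.
Proof.
rewrite !chiE glift_gconv /glift mulmx_suml; apply: eq_bigr => x _.
rewrite -scalemxAl mulmx_sumr; congr (_ *: _); apply: eq_bigr => y _.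
by rewrite -scalemxAr repr_mxM ?inE.
Qed.

(** The regular matrix of [a] splits along the Wedderburn components. Each irreducible
    representation kills the other components and is injective on its own, so all parts vanish. *)
Let chi_faithful (a : A) : (forall i, chi i a = 0) -> a = 0.
Proof.
move=> chi0; pose M := \sum_x coeff a x *: regular_repr K G x.
have opM i : gring_op (irr_repr i) M = chi i a.
  rewrite chiE linear_sum; apply: eq_bigr => x _.
  by rewrite linearZ /= gring_opG ?inE.
have : (M \in \sum_(i : sG) Wedderburn_subring i)%MS.
  rewrite Wedderburn_sum_pchar // linear_sum summx_sub // => x _.
  by rewrite linearZ scalemx_sub ?envelop_mx_id ?inE.
case/memmx_sumsP=> M_ defM RM.
have M0 : M = 0.
  rewrite defM big1 // => i _.
  have op0 : gring_op (irr_repr i) (M_ i) = 0.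
    have := opM i; rewrite chi0 defM linear_sum (bigD1 i) //= big1 ?addr0 // => j ji.
    by apply: irr_repr'_op0_pchar (RM j).
  have := @regular_op_inj_pchar _ _ _ sG K'G _ (irr_repr i) (socle_irr i).
  rewrite irr_reprK_pchar // => inj; apply: inj.
  - exact: RM.
  - by rewrite inE /= linear0 sub0mx.
  - by rewrite op0 linear0.
apply/ffunP=> x; rewrite -[LHS]/(coeff a x) [RHS]ffunE.
(* [gring_proj x] reads the coefficient of [x] off the regular matrix. *)
have := congr1 (fun N => gring_proj x N 0 0) M0.
rewrite linear_sum (bigD1 x) //= big1 => [|y /negPf ne]; last first.
  by rewrite linearZ /= gring_projE ?inE // eq_sym ne scaler0.
by rewrite addr0 linearZ /= gring_projE ?inE // eqxx linear0 !mxE mulr1.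
Qed.

Let common_kernel (s : seq sG) : {vspace A} := (\bigcap_(i <- s) lker (chi i))%VS.

Let mem_common_kernel s a : (a \in common_kernel s) = all (fun i => chi i a == 0) s.
Proof.
rewrite /common_kernel; elim: s => [|i s IH]; first by rewrite big_nil memvf.
by rewrite big_cons memv_cap memv_ker IH.
Qed.

Let arith n S u v w u0 v0 w0 ui vi wi uk vk wk :
  (4 * (ui + vi) <= 5 * n + 4 * wi ->
   4 * (u + v) + 4 * w0 <= 5 * S + 4 * w + 4 * (u0 + v0) ->
   uk + ui = u0 -> vk + vi = v0 -> wk + wi = w0 ->
   4 * (u + v) + 4 * wk <= 5 * (n + S) + 4 * w + 4 * (uk + vk))%N.
Proof. by lia. Qed.

Let arith_total u v w n :
  (4 * (u + v) + 4 * 0 <= 5 * n + 4 * w + 4 * (0 + 0) ->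
   3 * n + 4 * (u + v) <= 4 * (2 * n + w))%N.
Proof. by lia. Qed.

(** Each new representation maps the intersections with the kernel [L] reached so far into a matrix
    algebra, where the matrix bound applies because [L] is closed under products. Rank-nullity then
    adds up the bounds. *)
Let filtered_bound s (U V W : {vspace A}) :
  (forall u v, u \in U -> v \in V -> gconv u v \in W) ->
  (4 * (\dim U + \dim V) + 4 * \dim (W :&: common_kernel s) <=
   5 * (\sum_(i <- s) irr_degree i ^ 2) + 4 * \dim W +
   4 * (\dim (U :&: common_kernel s) + \dim (V :&: common_kernel s)))%N.
Proof.
move=> UVW; elim: s => [|i s IH].
  by rewrite /common_kernel !big_nil !capvf addnC add0n.
set L := common_kernel s in IH *.
have LE Y : (Y :&: common_kernel (i :: s) = Y :&: L :&: lker (chi i))%VS.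
  by rewrite /common_kernel big_cons -/L [(lker _ :&: _)%VS]capvC capvA.
have mulL u v : u \in L -> v \in L -> gconv u v \in L.
  rewrite !mem_common_kernel => /allP uL _; apply/allP=> j sj.
  by rewrite chiM (eqP (uL j sj)) mul0mx.
have := matrix_subspace_mul_bound infK
  (U := chi i @: (U :&: L)) (V := chi i @: (V :&: L)) (W := chi i @: (W :&: L)).
have UVWi : forall u v, u \in (chi i @: (U :&: L))%VS -> v \in (chi i @: (V :&: L))%VS ->
  u *m v \in (chi i @: (W :&: L))%VS.
  move=> _ _ /memv_imgP[u /memv_capP[Uu Lu] ->] /memv_imgP[v /memv_capP[Vv Lv] ->].
  by rewrite -chiM memv_img // memv_cap UVW ?mulL.
move=> /(_ UVWi) bound_i; rewrite !LE big_cons.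
exact: arith bound_i IH (limg_ker_dim (chi i) (U :&: L))
  (limg_ker_dim (chi i) (V :&: L)) (limg_ker_dim (chi i) (W :&: L)).
Qed.

(** By faithfulness nothing is left in the common kernel of all irreducible representations, and
    their squared degrees add up to the group order. *)
Lemma mul_bound_semisimple : mul_bound K gT (3 * #|gT|) 4.
Proof.
move=> U V W UVW; have := filtered_bound (enum sG) UVW.
have -> : common_kernel (enum sG) = 0%VS.
  apply/vspaceP=> a; rewrite mem_common_kernel memv0; apply/allP/eqP => [a0 | -> i _].
    by apply: chi_faithful => i; apply/eqP/a0; rewrite mem_enum.
  by rewrite linear0.
rewrite !capv0 !dimv0 big_enum /= sum_irr_degree_pchar // cardsT.
exact: arith_total.
Qed.

End Semisimple.

(** * Induction on the exponent of [p] *)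

Lemma leq_mul_bound (K : fieldType) gT c c' k :
  (c' <= 2 * c)%N -> mul_bound K gT c k -> mul_bound K gT c' (2 * k).
Proof. by move=> cc' bound U V W UVW; have := bound U V W UVW; nia. Qed.

(** [K] is existential because it is a splitting field for the last quotient, of order [r], known
    only at the end of the descent through central quotients. *)
Lemma exists_mul_bound n p r (F : fieldType) (gT : finGroupType) :
  prime p -> p \in [pchar F] -> infinite_field F -> coprime p r ->
  nilpotent [set: gT] -> #|gT| = (p ^ n * r)%N ->
  exists (K : fieldType) (_ : {rmorphism F -> K}),
    mul_bound K gT (3 * p ^ n * r) (2 ^ (n + 2)).
Proof.
move=> p_pr pF infF cpr; elim: n gT => [|n IH] gT nilG cardG.
  (* Splitting fields and socles exist only classically, that is, for proving boolean goals; hence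
     the detour through [asboolP]. *)
  apply/asboolP; have := @group_splitting_field_exists gT [set: gT]%G F.
  apply=> -[K f splitG]; have := @socle_exists K gT [set: gT]%G _ (regular_repr K _).
  apply=> sG; apply/asboolP; exists K, f.
  have K'G : ([pchar K]^').-group%g [set: gT].
    rewrite /pgroup cardsT cardG mul1n.
    rewrite (eq_pnat _ (eq_negn (pcharf_eq (rmorph_pchar f pF)))).
    by rewrite p'natE // -prime_coprime.
  have := mul_bound_semisimple (infinite_field_rmorph f infF) sG K'G splitG.
  by rewrite cardG !mul1n muln1.
have pZ : (p %| #|'Z([set: gT])%g|)%N.
  have r_gt0 : (0 < r)%N.
    by rewrite -(@ltn_pmul2l (p ^ n.+1)) ?expn_gt0 ?prime_gt0 // muln0 -cardG; apply/card_gt0P; exists 1%g.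
  have : p \in \pi(#|[set: gT]|).
    rewrite cardsT cardG mem_primes p_pr muln_gt0 expn_gt0 prime_gt0 // r_gt0 /=.
    by rewrite expnS -mulnA dvdn_mulr.
  by rewrite -(pi_center_nilpotent nilG) mem_primes => /and3P[].
have [z /centerP[_ cz] oz] := Cauchy p_pr pZ.
have czT x : (x * z = z * x)%g by apply/esym/cz; rewrite inE.
have cardQ : #|{: coset_of <[z]>%G}| = (p ^ n * r)%N.
  apply/eqP; rewrite -(eqn_pmul2l (prime_gt0 p_pr)) -(card_central_quotient czT oz).
  by rewrite cardG expnS mulnA.
have [K [f bound]] := IH _ (nilpotent_central_quotient z nilG) cardQ.
exists K, f; rewrite addSn [(2 ^ _)%N]expnS.
apply: leq_mul_bound (mul_bound_quotient czT oz (rmorph_pchar f pF) bound).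
(* Keeping only half of the [p] layers costs the factor [2] by which the denominator grows. *)
have hp : (p <= 2 * uphalf p)%N by rewrite uphalf_half; have := odd_double_half p; lia.
by rewrite expnS; nia.
Qed.

(** * From slice decompositions to subspaces of the group algebra *)

Section SliceDecomposition.

Variables (K : fieldType) (gT : finGroupType).

(** Lets a lower bound proved over an extension field descend to [F]. *)
Lemma slice_decomposable_rmorph (F : fieldType) (f : {rmorphism F -> K}) s :
  slice_decomposable (@mul_tensor F gT) s -> slice_decomposable (@mul_tensor K gT) s.
Proof.
case=> a [b [ab [f1 [g1 [f2 [g2 [f3 [g3 E]]]]]]]]; exists a, b; split=> //.
exists (fun i x y => f (f1 i x y)), (fun i z => f (g1 i z)),
  (fun i x z => f (f2 i x z)), (fun i y => f (g2 i y)),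
  (fun i y z => f (f3 i y z)), (fun i x => f (g3 i x)) => x y z.
have := congr1 f (E x y z); rewrite /mul_tensor rmorph_nat => ->.
rewrite !rmorphD !rmorph_sum; congr (_ + _ + _);
by apply: eq_bigr => i _; rewrite rmorphM.
Qed.

Lemma dim_common_zeros (g : nat -> gT -> K) m n :
  exists2 U : {vspace group_algebra K gT}, (#|gT| <= \dim U + (n - m))%N &
    forall u, u \in U -> forall i, (m <= i < n)%N -> \sum_x coeff u x * g i x = 0.
Proof.
pose L : 'Hom(group_algebra K gT, 'rV[K]_(n - m)) :=
  linfun (glift (fun x => \row_j g (m + j)%N x)).
exists (lker L) => [|u].
  have := limg_ker_dim L fullv; rewrite capfv dimvf dim_group_algebra => <-.
  by rewrite leq_add2l (leq_trans (dimvS (subvf _))) // dimvf dim_matrix mul1r.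
rewrite memv_ker lfunE /= => /eqP/rowP Lu i /andP[mi ni].
have lt : (i - m < n - m)%N by rewrite ltn_sub2r // (leq_ltn_trans mi).
have := Lu (Ordinal lt); rewrite !mxE summxE => Lu0; rewrite -[RHS]Lu0.
by apply: eq_bigr => x _; rewrite !mxE /= subnKC.
Qed.

Lemma coeff_gconv (a b : group_algebra K gT) z :
  coeff (gconv a b) z = \sum_x \sum_y coeff a x * coeff b y * mul_tensor K x y z.
Proof.
rewrite coeff_glift; apply: eq_bigr => x _; rewrite coeff_glift mulr_sumr.
by apply: eq_bigr => y _; rewrite coeff_gdelta mulrA /mul_tensor eq_sym.
Qed.

(** Let [U] be the common zeros of the [g3 i], [V] those of the [g2 i], and [W] the span of the
    [g1 i]. Then [codim U], [codim V] and [dim W] are at most [s - b], [b - a] and [a], with sum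
    [s]. *)
Lemma slice_mul_bound c k s :
  mul_bound K gT c k -> slice_decomposable (@mul_tensor K gT) s -> (c <= k * s)%N.
Proof.
move=> bound [a [b [/andP[ab bs] [f1 [g1 [f2 [g2 [f3 [g3 E]]]]]]]]].
have [U dimU U0] := dim_common_zeros g3 b s.
have [V dimV V0] := dim_common_zeros g2 a b.
pose w i : group_algebra K gT := [ffun z => g1 i z] : {ffun gT -> K^o}.
pose W := <<[seq w i | i <- iota 0 a]>>%VS.
have dimW : (\dim W <= a)%N by rewrite (leq_trans (dim_span _)) // size_map size_iota.
have UVW u v : u \in U -> v \in V -> gconv u v \in W.
  move=> Uu Vv.
  pose e i := \sum_x \sum_y coeff u x * coeff v y * f1 i x y.
  have conv_z z : coeff (gconv u v) z = \sum_(0 <= i < a) e i * g1 i z.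
    rewrite coeff_gconv.
    have -> : \sum_x \sum_y coeff u x * coeff v y * mul_tensor K x y z =
        \sum_x \sum_y coeff u x * coeff v y * (\sum_(0 <= i < a) f1 i x y * g1 i z) +
        \sum_x \sum_y coeff u x * coeff v y * (\sum_(a <= i < b) f2 i x z * g2 i y) +
        \sum_x \sum_y coeff u x * coeff v y * (\sum_(b <= i < s) f3 i y z * g3 i x).
      rewrite -!big_split /=; apply: eq_bigr => x _; rewrite -!big_split /=.
      by apply: eq_bigr => y _; rewrite E !mulrDr.
    (* The second group of slices vanishes on summing over [y], since [v] is in [V]; the third
       vanishes over [x], since [u] is in [U]. *)
    rewrite [X in _ + X + _]big1 => [|x _]; last first.
      under eq_bigr => y _ do rewrite mulr_sumr.
      rewrite exchange_big big_nat_cond big1 //= => i /andP[/(V0 v Vv) v0 _].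
      transitivity (coeff u x * f2 i x z * \sum_y coeff v y * g2 i y); last by rewrite v0 mulr0.
      by rewrite mulr_sumr; apply: eq_bigr => y _; rewrite mulrACA.
    rewrite [X in _ + X](_ : _ = 0) ?addr0; last first.
      rewrite exchange_big big1 //= => y _.
      under eq_bigr => x _ do rewrite mulr_sumr.
      rewrite exchange_big big_nat_cond big1 //= => i /andP[/(U0 u Uu) u0 _].
      transitivity (coeff v y * f3 i y z * \sum_x coeff u x * g3 i x); last by rewrite u0 mulr0.
      by rewrite mulr_sumr; apply: eq_bigr => x _; rewrite [coeff u x * _]mulrC mulrACA.
    under eq_bigr => x _ do under eq_bigr => y _ do rewrite mulr_sumr.
    under eq_bigr => x _ do rewrite exchange_big /=.
    rewrite exchange_big /=; apply: eq_bigr => i _; rewrite mulr_suml.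
    by apply: eq_bigr => x _; rewrite mulr_suml; apply: eq_bigr => y _; rewrite mulrA.
  have -> : gconv u v = \sum_(0 <= i < a) e i *: w i.
    apply/ffunP=> z; rewrite -[LHS]/(coeff _ z) conv_z sum_ffunE.
    by apply: eq_bigr => i _; rewrite !ffunE.
  rewrite big_seq; apply: memv_suml => i; rewrite mem_index_iota => /andP[_ ia].
  by rewrite memvZ // memv_span // map_f // mem_iota.
by have := bound U V W UVW; nia.
Qed.

End SliceDecomposition.

Theorem theoremA7 (p n r : nat) (G : finGroupType) (F : fieldType) :
  prime p ->
  nilpotent [set: G] ->
  #|G| = (p ^ n * r)%N ->
  gcdn p r = 1%N ->
  p \in [pchar F] ->
  (3 * p%:R ^+ n * r%:R) / 2 ^+ (n + 2) <= (slice_rank (@mul_tensor F G))%:R :> rat.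
Proof.
move=> p_pr nilG cardG cpr pF.
(* [F] may be finite, so the bound is proved over an extension of its rational function field. *)
have pF1 : p \in [pchar {fraction {poly F}}].
  by apply/(rmorph_pchar (@tofrac {poly F}))/(rmorph_pchar (@polyC F)).
have [K [f bound]] := exists_mul_bound p_pr pF1 (@infinite_fraction_poly F)
  (introT eqP cpr) nilG cardG.
rewrite /slice_rank; case: ex_minnP => s /asboolP sF _.
have sK := slice_decomposable_rmorph (f \o (@tofrac {poly F} \o polyC)) sF.
have le := slice_mul_bound bound sK.
by rewrite ler_pdivrMr ?exprn_gt0 // -!natrX -!natrM ler_nat [leqRHS]mulnC.
Qed.
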